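(* Let $f, g : \mathbb{R}^d \to [0,\infty)$ be measurable functions with $\int_{\mathbb{R}^d} f(x)\,dx = \int_{\mathbb{R}^d} g(x)\,dx = 1$, and let $\Lambda \subseteq \mathbb{R}^d$ be a set such that both $f + \Lambda$ and $g + \Lambda$ are packings of $\mathbb{R}^d$. Then $f + \Lambda$ is a tiling of $\mathbb{R}^d$ if and only if $g + \Lambda$ is a tiling of $\mathbb{R}^d$.
   Context: For a nonnegative measurable function $f$ on $\mathbb{R}^d$ and $\Lambda \subseteq \mathbb{R}^d$: ''$f + \Lambda$ is a packing'' means $\sum_{\lambda \in \Lambda} f(x - \lambda) \le 1$ for a.e. $x \in \mathbb{R}^d$; ''$f + \Lambda$ is a tiling'' means $\sum_{\lambda \in \Lambda} f(x - \lambda) = 1$ for a.e. $x \in \mathbb{R}^d$. *)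

(* Defs.v *)
From HB Require Import structures.
From mathcomp Require Import all_boot all_order all_algebra.
From mathcomp Require Import all_classical all_reals all_analysis.

Set Implicit Arguments.
Unset Strict Implicit.
Unset Printing Implicit Defensive.

Import Order.TTheory GRing.Theory Num.Theory.
Import numFieldNormedType.Exports.

Local Open Scope classical_set_scope.
Local Open Scope ring_scope.

Section lebesgue_outer_measure.
Context {R : realType} {d : nat}.
Implicit Types (p : 'rV[R]_d * 'rV[R]_d) (A : set 'rV[R]_d).
Local Open Scope ereal_scope.

Definition box p : set 'rV[R]_d :=
  [set x | forall i, (p.1 ord0 i <= x ord0 i <= p.2 ord0 i)%R].

(* Each side is truncated at 0 because [box p] is empty as soon as one side of
   p is reversed. *)
Definition box_volume p : R :=
  (\prod_(i < d) Num.max 0 (p.2 ord0 i - p.1 ord0 i))%R.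

(* Countable families rather than sequences: for d = 0 every nonempty box has
   volume 1, so finite covers must be allowed. *)
Definition box_cover A : set (set ('rV[R]_d * 'rV[R]_d)) :=
  [set C | countable C /\ A `<=` \bigcup_(p in C) box p].

Definition lebesgue_outer A : \bar R :=
  ereal_inf [set \esum_(p in C) (box_volume p)%:E | C in box_cover A].

Lemma box_volume_ge0 p : (0 <= box_volume p)%R.
Proof. by apply: prodr_ge0 => i _; rewrite le_max lexx. Qed.

Lemma lebesgue_outer_ge0 A : 0 <= lebesgue_outer A.
Proof.
apply: le_ereal_inf_tmp => _ [C _ <-].
by apply: esum_ge0 => p _; rewrite lee_fin box_volume_ge0.
Qed.

Lemma lebesgue_outer0 : lebesgue_outer set0 = 0.
Proof.
apply/eqP; rewrite eq_le lebesgue_outer_ge0 andbT.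
apply: ereal_inf_lbound; exists set0; last by rewrite esum_set0.
by split; [exact: countable0|exact: sub0set].
Qed.

Lemma le_lebesgue_outer :
  {homo lebesgue_outer : A B / A `<=` B >-> A <= B}.
Proof.
move=> A B AB; apply: ereal_inf_le_tmp => _ [C [cC BC] <-].
by exists C => //; split=> //; exact: subset_trans BC.
Qed.

Lemma lebesgue_outer_sigma_subadditive : sigma_subadditive lebesgue_outer.
Proof.
move=> A; have [[i ioo]|] := pselect (exists i, lebesgue_outer (A i) = +oo).
  rewrite (eseries_pinfty _ _ ioo) ?leey// => n _.
  by rewrite -ltNye (lt_le_trans _ (lebesgue_outer_ge0 _)).
rewrite -forallNE => Aoo.
apply/lee_addgt0Pr => e e0.
apply: le_trans (epsilon_trick xpredT (fun n => lebesgue_outer_ge0 (A n)) (ltW e0)).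
pose P n C := box_cover (A n) C /\ \esum_(p in C) (box_volume p)%:E <=
  lebesgue_outer (A n) + (e / (2 ^ n.+1)%:R)%:E.
have [C PC] : {C : nat -> set ('rV[R]_d * 'rV[R]_d) & forall n, P n (C n)}.
  apply: (@choice _ _ P) => n.
  have fin : lebesgue_outer (A n) \is a fin_num.
    by rewrite ge0_fin_numE ?lebesgue_outer_ge0// ltey; apply/eqP/Aoo.
  have en : (0 < e / (2 ^ n.+1)%:R)%R by rewrite divr_gt0// ltr0n expn_gt0.
  have [_ [B cB <-] /ltW lB] := lb_ereal_inf_adherent en fin.
  by exists B.
have v0 p : 0 <= (box_volume p)%:E by rewrite lee_fin box_volume_ge0.
apply: (@le_trans _ _ (\esum_(p in \bigcup_n C n) (box_volume p)%:E)).
  apply: ereal_inf_lbound; exists (\bigcup_n C n) => //; split.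
    by apply: bigcup_countable => // n _; exact: (PC n).1.1.
  move=> x [n _ /(PC n).1.2[p Cp px]]; exists p => //.
  by exists n.
rewrite seqDU_bigcup_eq (@esum_bigcupT _ _ _ _ _ (@trivIset_seqDU _ C) v0).
rewrite nneseries_esumT//.
  apply: le_esum => n _; apply: le_trans (PC n).2.
  rewrite esum_mkcond [leRHS]esum_mkcond; apply: le_esum => p _.
  case: ifPn => [/set_mem/(@subset_seqDU _ C) Cp|_]; first by rewrite mem_set.
  by case: ifPn.
by move=> n; rewrite adde_ge0 ?lebesgue_outer_ge0// lee_fin divr_ge0// ltW.
Qed.

HB.instance Definition _ := isOuterMeasure.Build R 'rV[R]_d lebesgue_outer
  lebesgue_outer0 lebesgue_outer_ge0 le_lebesgue_outer
  lebesgue_outer_sigma_subadditive.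

End lebesgue_outer_measure.

(* R^d carrying the sigma-algebra of all Lebesgue measurable sets, not only the
   Borel ones. *)
Notation lebesgue_space R d := (caratheodory_type (@lebesgue_outer R d)).

Definition lebesgue_measureRd (R : realType) (d : nat) :
  set (lebesgue_space R d) -> \bar R := @lebesgue_outer R d.
Arguments lebesgue_measureRd : clear implicits.

HB.instance Definition _ (R : realType) (d : nat) :=
  isMeasure.Build _ _ _ (lebesgue_measureRd R d)
    (@caratheodory_measure0 _ _ (@lebesgue_outer R d))
    (@caratheodory_measure_ge0 _ _ (@lebesgue_outer R d))
    (@caratheodory_measure_sigma_additive _ _ (@lebesgue_outer R d)).

Section packing_tiling.
Context {R : realType} {d : nat}.
Implicit Types (f : 'rV[R]_d -> R) (L : set 'rV[R]_d).
Local Open Scope ereal_scope.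

(* L is an arbitrary, possibly uncountable set: \esum is the supremum of the
   finite partial sums. *)
Definition is_packing f L :=
  {ae lebesgue_measureRd R d,
    forall x : 'rV[R]_d, \esum_(l in L) (f (x - l)%R)%:E <= 1}.

Definition is_tiling f L :=
  {ae lebesgue_measureRd R d,
    forall x : 'rV[R]_d, \esum_(l in L) (f (x - l)%R)%:E = 1}.

End packing_tiling.

(* Main.v *)
(* Write F and G for the sums of the translates of f and of g over L. Since
   F = 1 a.e., exchanging sum and integral gives, for every t,
   1 = \int g(t - x) F(x) dx = \int f(y) G(t - y) dy, while G <= 1 a.e. and f has
   integral 1; hence the set {f <> 0} meets t - {G <> 1} in a null set. This
   holds for every t, in particular for every rational t, and the union of the
   sets t - {G <> 1} over the rational t is invariant under rational
   translations, so by ergodicity it is null or has null complement. Its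
   complement contains almost all of {f <> 0}, which is not null, so {G <> 1}
   is null. *)
Require Import Defs.
From mathcomp Require Import all_boot all_order all_algebra.
From mathcomp Require Import all_classical all_reals all_analysis.
From mathcomp Require Import measurable_realfun.
From mathcomp Require Import lra ring zify.

Import Order.TTheory GRing.Theory Num.Theory.
Import numFieldNormedType.Exports.

Local Open Scope classical_set_scope.
Local Open Scope ring_scope.

(** * Lebesgue outer measure *)

(* Equality would need [e] to be injective on [P]. *)
Lemma le_esum_image (R : realType) (T T' : choiceType) (P : set T)
    (e : T -> T') (a : T' -> \bar R) : (forall j, 0 <= a j)%E ->
  (\esum_(j in e @` P) a j <= \esum_(i in P) a (e i))%E.
Proof.
move=> a0; apply: ge_ereal_sup => _ [X [finX XeP] <-].
(* A finite part [X] of the image is lifted to a finite [Y] on which [e] is injective, by choosing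
   one preimage per point; the empty [X] is handled apart because [T] may have no element to serve
   as a default. *)
have [Y [finY YP] [eYX Yinj]] :
    exists2 Y, finite_set Y /\ Y `<=` P & e @` Y = X /\ set_inj Y e.
  have [XP|nX] := pselect (exists y, X y); last first.
    exists set0; first by split.
    split.
      by rewrite image_set0; apply/seteqP; split => // y Xy; case: nX; exists y.
    by move=> x y; rewrite inE.
  have [x0 _] : exists x, P x by case: XP => y /XeP[x Px _]; exists x.
  have [s sP] : {s : T' -> T & forall j, X j -> P (s j) /\ e (s j) = j}.
    apply: (@choice _ _ (fun j y => X j -> P y /\ e y = j)) => j.
    have [/XeP[x Px <-]|nj] := pselect (X j); first by exists x.
    by exists x0.
  exists (s @` X).
    split; first exact: finite_image.
    by move=> _ [j Xj <-]; exact: (sP j Xj).1.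
  split.
    apply/seteqP; split => [_ [_ [j Xj <-] <-]|j Xj]; first by rewrite (sP j Xj).2.
    by exists (s j); [exists j|exact: (sP j Xj).2].
  move=> _ _ /[!inE]/= -[j Xj <-] [k Xk <-].
  by rewrite (sP j Xj).2 (sP k Xk).2 => ->.
apply: esum_ge; exists Y => //.
by rewrite -eYX (reindex_fsbig e Y)//; apply: inj_bij.
Qed.

(** * Invariance of the outer measure and measurability of half-spaces *)

Section lebesgue_outer_box.
Context {R : realType} {d : nat}.
Implicit Types (p : 'rV[R]_d * 'rV[R]_d) (A C X : set 'rV[R]_d) (t x : 'rV[R]_d).
Local Open Scope ereal_scope.

(** The map x -> t - x turns a box with corners a, b into one with corners t - b, t - a of the same
    volume, so it carries covers to covers. Being an involution, it yields equality from one
    inequality. *)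
Lemma lebesgue_outer_reflect t A :
  lebesgue_outer [set x | A (t - x)%R] = lebesgue_outer A.
Proof.
suff le_refl (B : set 'rV[R]_d) :
    lebesgue_outer [set x | B (t - x)%R] <= lebesgue_outer B.
  apply/eqP; rewrite eq_le le_refl/=.
  have {1}-> : A = [set x | [set y | A (t - y)%R] (t - x)%R].
    by apply/seteqP; split => x /=; rewrite opprB addrC subrK.
  exact: le_refl.
apply: le_ereal_inf_tmp => _ [C [cC BC] <-].
pose e p : 'rV[R]_d * 'rV[R]_d := (t - p.2, t - p.1)%R.
have ev p : box_volume (e p) = box_volume p.
  by apply: eq_bigr => i _; rewrite !mxE; congr Num.max; ring.
apply: (@le_trans _ _ (\esum_(p in e @` C) (box_volume p)%:E)).
  apply: ereal_inf_lbound; exists (e @` C) => //; split.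
    exact: card_le_trans (card_image_le _ _) cC.
  move=> x /= /BC[p Cp px]; exists (e p); first by exists p.
  by move=> i; have := px i; rewrite !mxE => /andP[? ?]; apply/andP; split; lra.
apply: le_trans (le_esum_image _ _ _ _ _ _ _) _.
  by move=> p; rewrite lee_fin box_volume_ge0.
by under eq_esum do rewrite ev.
Qed.

(** A translation is the composite of two reflections. *)
Lemma lebesgue_outer_translate t A :
  lebesgue_outer [set x | A (x + t)%R] = lebesgue_outer A.
Proof.
rewrite -[RHS](lebesgue_outer_reflect t) -[RHS](lebesgue_outer_reflect 0).
by congr lebesgue_outer; apply/seteqP; split => x /=; rewrite sub0r opprK addrC.
Qed.

Lemma lebesgue_outer_box p : lebesgue_outer (box p) <= (box_volume p)%:E.
Proof.
apply: ereal_inf_lbound; exists [set p].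
  by split; [exact: countable1|move=> x px; exists p].
by rewrite esum_set1// lee_fin box_volume_ge0.
Qed.

(** Cutting each box of a cover along the hyperplane x_i = a gives covers of the two pieces of [X]
    whose total volumes add up to that of the original cover. *)
Lemma measurable_coord_le (i : 'I_d) (a : R) :
  lebesgue_outer.-caratheodory [set x : 'rV[R]_d | (x ord0 i <= a)%R].
Proof.
apply: le_caratheodory_measurable => X.
apply: le_ereal_inf_tmp => _ [C [cC XC] <-].
(* If [p] lies strictly on one side of the hyperplane, the part on the other side is reversed, and
   the truncation in [box_volume] gives it volume 0. *)
pose lo p : 'rV[R]_d * 'rV[R]_d :=
  (p.1, \row_j if j == i then Num.min (p.2 ord0 j) a else p.2 ord0 j)%R.
pose hi p : 'rV[R]_d * 'rV[R]_d :=
  (\row_j (if j == i then Num.max (p.1 ord0 j) a else p.1 ord0 j), p.2)%R.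
have lohi p : (box_volume p = box_volume (lo p) + box_volume (hi p))%R.
  have v1 q : box_volume q = (Num.max 0 (q.2 ord0 i - q.1 ord0 i) *
      \prod_(j < d | j != i) Num.max 0 (q.2 ord0 j - q.1 ord0 j))%R.
    by rewrite /box_volume (bigD1 i).
  rewrite !v1 /= !mxE !eqxx.
  have h (q r : 'rV[R]_d * 'rV[R]_d) :
    (forall j, j != i -> q.1 ord0 j = r.1 ord0 j /\ q.2 ord0 j = r.2 ord0 j) ->
    (\prod_(j < d | j != i) Num.max 0 (q.2 ord0 j - q.1 ord0 j) =
     \prod_(j < d | j != i) Num.max 0 (r.2 ord0 j - r.1 ord0 j))%R.
    by move=> qr; apply: eq_bigr => j /qr[-> ->].
  rewrite -(h p (lo p)); first rewrite -(h p (hi p)).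
  - rewrite -mulrDl; congr (_ * _)%R.
    rewrite !maxEle !minEle; repeat case: ifPn; rewrite -?ltNge; lra.
  - by move=> j /negbTE ji; rewrite !mxE ji.
  - by move=> j /negbTE ji; rewrite !mxE ji.
have v0 p : 0 <= (box_volume p)%:E by rewrite lee_fin box_volume_ge0.
under eq_esum do rewrite lohi EFinD.
rewrite esumD//; apply: leeD.
  apply: (le_trans _ (le_esum_image _ _ _ C lo (fun p => (box_volume p)%:E) v0)).
  apply: ereal_inf_lbound; exists (lo @` C) => //; split.
    exact: card_le_trans (card_image_le _ _) cC.
  move=> x [/XC[p Cp px] /= xa]; exists (lo p); first by exists p.
  move=> j; have /andP[-> pj]:= px j; rewrite !mxE.
  by case: eqP => [ji|//]; rewrite le_min pj/= ji.
apply: (le_trans _ (le_esum_image _ _ _ C hi (fun p => (box_volume p)%:E) v0)).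
apply: ereal_inf_lbound; exists (hi @` C) => //; split.
  exact: card_le_trans (card_image_le _ _) cC.
move=> x [/XC[p Cp px] /= /negP xa]; exists (hi p); first by exists p.
move=> j; have /andP[pj ->]:= px j; rewrite !mxE andbT.
by case: eqP => [ji|//]; rewrite ge_max pj/= ji ltW// ltNge.
Qed.

End lebesgue_outer_box.

(** * Ergodicity of the rational translations *)

Lemma fsum_cst (R : realType) (T : finType) (P : pred T) (c : \bar R) :
  (0 <= c)%E -> (\sum_(i \in [set i | P i]) c = #|P|%:R%:E * c)%E.
Proof.
move=> c0; rewrite (_ : [set i | P i] = [set` enum P]); last first.
  by apply/seteqP; split => i /=; rewrite mem_enum.
rewrite -fsbig_seq ?enum_uniq// big_enum/= sumr_const.
elim: #|P| => [|n IH]; first by rewrite mulr0n mul0e.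
by rewrite mulrSr IH -natr1 EFinD ge0_muleDl ?mul1e ?lee_fin.
Qed.

Lemma lebesgue_outer_countable0 (R : realType) (d : nat) (I : countType)
    (F : I -> set 'rV[R]_d) :
  (forall i, lebesgue_outer (F i) = 0)%E -> (lebesgue_outer (\bigcup_i F i) = 0)%E.
Proof.
move=> F0; apply/eqP; rewrite eq_le lebesgue_outer_ge0 andbT.
pose G n := if unpickle n is Some i then F i else set0.
apply: (@le_trans _ _ (lebesgue_outer (\bigcup_n G n))).
  apply: le_lebesgue_outer => x [i _ Fix]; exists (pickle i) => //.
  by rewrite /G pickleK.
apply: le_trans (lebesgue_outer_sigma_subadditive _) _.
rewrite eseries0// => n _ _; rewrite /G.
by case: unpickle => [i|]; [exact: F0|exact: lebesgue_outer0].
Qed.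

(** Turns sums over countable sets into series; the indices form a subset [S] of nat because [A] may
    be finite. *)
Lemma countable_enum (T : pointedType) (A : set T) : countable A ->
  exists (S : set nat) (e : nat -> T), set_inj S e /\ A = e @` S.
Proof.
move=> /countable_bijP[S]; rewrite card_eq_sym => /pcard_eqP/bijPex[e eb].
by exists S, e; split; [exact: set_bij_inj eb|rewrite (image_eq eb)].
Qed.

(** * Density of a rationally invariant set *)

Section rational_invariance.
Context {R : realType} {d : nat}.
Implicit Types (p : 'rV[R]_d * 'rV[R]_d) (k : 'rV[int]_d) (C : set 'rV[R]_d).

(* The cell of index k is the product of the intervals ](k_i - 1)/n, k_i/n]. *)
Definition cell (n : nat) k : set 'rV[R]_d :=
  [set x | forall i, Num.ceil (n%:R * x ord0 i) = k ord0 i].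

Lemma measurable_cell n k :
  measurable (cell n.+1 k : set (lebesgue_space R d)).
Proof.
pose H i (a : R) : set (lebesgue_space R d) := [set x : 'rV[R]_d | x ord0 i <= a].
have mH i a : measurable (H i a) by exact: measurable_coord_le.
rewrite [X in measurable X](_ : _ = \bigcap_i
    (H i ((k ord0 i)%:~R / n.+1%:R) `\` H i ((k ord0 i - 1)%:~R / n.+1%:R))).
  by apply: fin_bigcap_measurable => // i _; exact: measurableD.
have n0 : 0 < n.+1%:R :> R by rewrite ltr0n.
apply/seteqP; split => x /= xk i => [_|].
  have := ceil_itv (n.+1%:R * x ord0 i); rewrite xk => /andP[k1 k2].
  split; first by rewrite /H /= ler_pdivlMr// mulrC.
  by apply/negP; rewrite -ltNge ltr_pdivrMr// mulrC.
have [k1 /negP] := xk i Logic.I; rewrite -ltNge => k2.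
apply: ceil_def; rewrite mulrC -ltr_pdivrMr// k2/=.
by move: k1; rewrite /H/= ler_pdivlMr.
Qed.

Lemma trivIset_cell n : trivIset [set: 'rV[int]_d] (cell n).
Proof.
by move=> k l _ _ [x [xk xl]]; apply/rowP => i; rewrite -xk -xl.
Qed.

Definition rational_invariant C := forall (q : 'rV[rat]_d) (x : 'rV[R]_d),
  C (x + map_mx ratr q) <-> C x.

Context (C : set 'rV[R]_d) (mC : measurable (C : set (lebesgue_space R d)))
  (Crat : rational_invariant C).
Local Notation nu E := (lebesgue_outer (C `&` E)).

(** Translation by the rational vector -k/(n+1) takes the cell of index k to that of index 0 and
    preserves [C]. *)
Lemma lebesgue_outer_invariant_cell n k : nu (cell n.+1 k) = nu (cell n.+1 0).
Proof.
pose q : 'rV[rat]_d := \row_i (- (k ord0 i)%:~R / n.+1%:R).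
rewrite -(lebesgue_outer_translate (map_mx ratr q) (C `&` cell n.+1 0)).
have E (x : 'rV[R]_d) i : n.+1%:R * (x + map_mx ratr q) ord0 i =
    n.+1%:R * x ord0 i - (k ord0 i)%:~R.
  rewrite !mxE rmorphM/= fmorphV/= rmorphN/= rmorph_nat ratr_int.
  by rewrite mulrDr [in X in _ + X]mulrCA mulfV ?mulr1// pnatr_eq0.
have ceilBz (y : R) (z : int) : Num.ceil (y - z%:~R) = Num.ceil y - z.
  by rewrite -rmorphN ceilDrz ?intr_int// intrKceil.
congr lebesgue_outer; apply/seteqP; split => x /= [Cx xk]; split.
- by apply/Crat.
- by move=> i; rewrite E ceilBz xk mxE subrr.
- by move/Crat: Cx.
- move=> i; have := xk i; rewrite E ceilBz mxE.
  by move/eqP; rewrite subr_eq0 => /eqP.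
Qed.

Local Open Scope ereal_scope.
Local Notation mu := (lebesgue_measureRd R d).

Lemma lebesgue_outer_invariant_cell_le n :
  (n.+1 ^ d)%:R%:E * nu (cell n.+1 0) <= nu (cell 1 0).
Proof.
(* Coordinates 0, -1, ..., -n index the (n+1)^d disjoint small cells that fill [cell 1 0], the cube
   ]-1, 0]^d. *)
pose k (f : {ffun 'I_d -> 'I_n.+1}) : 'rV[int]_d := (\row_i - (f i : nat)%:Z)%R.
have mCk f : measurable (C `&` cell n.+1 (k f) : set (lebesgue_space R d)).
  by apply: measurableI => //; exact: measurable_cell.
have -> : (n.+1 ^ d)%:R%:E * nu (cell n.+1 0) =
    \sum_(f \in [set: {ffun 'I_d -> 'I_n.+1}]) mu (C `&` cell n.+1 (k f)).
  under eq_fsbigr do rewrite /lebesgue_measureRd lebesgue_outer_invariant_cell.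
  have := fsum_cst R _ (xpredT : pred {ffun 'I_d -> 'I_n.+1}) _
    (lebesgue_outer_ge0 (C `&` cell n.+1 0)).
  by rewrite card_ffun !card_ord set_true.
rewrite -measure_fin_bigcup//; first last.
- apply/trivIsetP => f g _ _ fg.
  have kfg : k f != k g.
    apply: contra fg => /eqP /rowP kE; apply/eqP/ffunP => i; apply/val_inj.
    by have /eqP := kE i; rewrite !mxE eqr_opp => /eqP [].
  have /trivIsetP/(_ _ _ Logic.I Logic.I kfg) cell0 := trivIset_cell n.+1.
  by rewrite setIACA cell0 setI0.
- exact: finite_finset.
apply: (@le_lebesgue_outer R d _ (C `&` cell 1 0)).
move=> x [f _ [Cx xf]]; split => // i.
rewrite mul1r mxE; apply: ceil_def; rewrite sub0r rmorphN/=.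
have := ceil_itv (n.+1%:R * x ord0 i)%R; rewrite xf mxE => /andP[].
have n0 : (0 < n.+1%:R :> R)%R by rewrite ltr0n.
have fn : ((f i)%:R <= n%:R :> R)%R by rewrite ler_nat -ltnS.
have f0 : (0 <= (f i)%:R :> R)%R by rewrite ler0n.
rewrite rmorphB rmorphN/= -!pmulrn => h1 h2; apply/andP; split.
  rewrite -(ltr_pM2l n0) mulrN1; apply: le_lt_trans h1.
  by rewrite -natr1; lra.
by rewrite -(ler_pM2l n0) mulr0; move: h2; rewrite mulrNz -pmulrn; lra.
Qed.

(** With N = n + 1, the cells meeting the box [a, b] have i-th index between the ceilings of N a_i
    and N b_i: at most N (b_i - a_i) + 2 values. *)
Lemma lebesgue_outer_invariant_box_cells p n :
  (forall i, (p.1 ord0 i <= p.2 ord0 i)%R) ->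
  nu (box p) <= (\prod_(i < d)
    (n.+1%:R * (p.2 ord0 i - p.1 ord0 i) + 2))%:E * nu (cell n.+1 0).
Proof.
move=> ab; pose a i := Num.ceil (n.+1%:R * p.1 ord0 i)%R.
pose m i := `|Num.ceil (n.+1%:R * p.2 ord0 i)%R - a i|%N.+1.
(* The common bound [M] lets the index tuples live in one finite function type; [F] then cuts axis i
   back to its own [m i] values. *)
pose M := (\max_i m i)%N.
pose F (i : 'I_d) := [pred j : 'I_M | (j < m i)%N].
pose k (f : {ffun 'I_d -> 'I_M}) : 'rV[int]_d := (\row_i (a i + (f i : nat)%:Z))%R.
have n0 : (0 < n.+1%:R :> R)%R by rewrite ltr0n.
have mCk f : measurable (C `&` cell n.+1 (k f) : set (lebesgue_space R d)).
  by apply: measurableI => //; exact: measurable_cell.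
pose D := [set f | f \in family F].
have finD : finite_set D by exact: finite_finset.
apply: (@le_trans _ _ (mu (\bigcup_(f in D) (C `&` cell n.+1 (k f))))).
  apply: (@le_lebesgue_outer R d (C `&` box p)).
  move=> x [Cx px].
  have ax i : (a i <= Num.ceil (n.+1%:R * x ord0 i))%R.
    by apply: le_ceil; rewrite ler_pM2l//; have /andP[] := px i.
  have xb i : (Num.ceil (n.+1%:R * x ord0 i) <= Num.ceil (n.+1%:R * p.2 ord0 i))%R.
    by apply: le_ceil; rewrite ler_pM2l//; have /andP[] := px i.
  have xm i : (`|Num.ceil (n.+1%:R * x ord0 i)%R - a i| < m i)%N.
    by rewrite ltnS; have := ax i; have := xb i; lia.
  have xM i : (`|Num.ceil (n.+1%:R * x ord0 i)%R - a i| < M)%N.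
    by apply: leq_trans (xm i) _; exact: leq_bigmax.
  exists [ffun i => Ordinal (xM i)].
    by apply/familyP => i; rewrite ffunE; exact: xm.
  by split=> // i; rewrite mxE ffunE/= gez0_abs ?subr_ge0// subrKC.
apply: (le_trans (@content_sub_fsum _ _ (lebesgue_space R d) mu _ D _
  (fun f => C `&` cell n.+1 (k f)) finD _ _ (@subset_refl _ _))) => //.
  exact: fin_bigcup_measurable.
rewrite (eq_fsbigr (fun=> nu (cell n.+1 0))); last first.
  by move=> f _; exact: lebesgue_outer_invariant_cell.
have := fsum_cst R _ (family F) _ (lebesgue_outer_ge0 (C `&` cell n.+1 0)).
rewrite -/D => ->; apply: lee_wpmul2r; first exact: lebesgue_outer_ge0.
rewrite lee_fin card_family foldrE big_image/= natr_prod.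
apply: ler_prod => i _; rewrite ler0n/=.
have -> : #|F i| = m i.
  rewrite -sum1_card (eq_bigl (fun j : 'I_M => (j < m i)%N))//.
  by rewrite (big_ord_narrow (leq_bigmax i)) sum1_card card_ord.
have := ceil_itv (n.+1%:R * p.2 ord0 i)%R => /andP[b1 b2].
have := ceil_itv (n.+1%:R * p.1 ord0 i)%R => /andP[a1 a2].
have ab0 : (0 <= Num.ceil (n.+1%:R * p.2 ord0 i)%R - a i)%R.
  by rewrite subr_ge0; apply: le_ceil; rewrite ler_pM2l.
rewrite /m -natr1 natr_absz ger0_norm// rmorphB/= mulrBr.
by move: b1; rewrite rmorphB/=; move: a2; rewrite -/(a i); lra.
Qed.

Lemma lebesgue_outer_cell_le1 : lebesgue_outer (cell 1 (0 : 'rV[int]_d)) <= 1%E.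
Proof.
pose q : 'rV[R]_d * 'rV[R]_d := (const_mx (-1), 0)%R.
apply: (@le_trans _ _ (lebesgue_outer (box q))).
  apply: le_lebesgue_outer => x x0 i; rewrite !mxE.
  have := ceil_itv (x ord0 i); have := x0 i.
  by rewrite mul1r mxE => -> /andP[/ltW]; rewrite sub0r rmorphN => -> ->.
apply: le_trans (lebesgue_outer_box _) _; rewrite lee_fin.
rewrite /box_volume big1// => i _; rewrite !mxE sub0r opprK.
by apply/max_idPr.
Qed.

Lemma lebesgue_outer_invariant_cell_le1 : nu (cell 1 0) <= 1%E.
Proof.
apply: le_trans lebesgue_outer_cell_le1.
by apply: le_lebesgue_outer; exact: subIsetr.
Qed.

(** Counting cells of side 1/N bounds the left side by c times the product of the w_i + 2/N, where c
    is the value on the unit cell and the w_i are the side lengths; then N tends to infinity. *)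
Lemma lebesgue_outer_invariant_box p :
  nu (box p) <= nu (cell 1 0) * (box_volume p)%:E.
Proof.
have nu0 E : 0 <= nu E by exact: lebesgue_outer_ge0.
have [ab|] := pselect (forall i, (p.1 ord0 i <= p.2 ord0 i)%R); last first.
  move=> /existsNP[i /negP ab]; rewrite (_ : box p = set0); last first.
    apply/seteqP; split => x // /(_ i)/andP[ax xb]; exfalso.
    by move/negP: ab; apply; exact: le_trans xb.
  by rewrite setI0 lebesgue_outer0 mule_ge0// lee_fin box_volume_ge0.
(* An infinite value on a small cell would force an infinite value on the unit cell, where it is at
   most 1. *)
have fin n : nu (cell n.+1 0) \is a fin_num.
  have nd0 : (0 < (n.+1 ^ d)%:R :> R)%R by rewrite ltr0n expn_gt0.
  rewrite ge0_fin_numE//; apply/contraPT: (lebesgue_outer_invariant_cell_le n).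
  rewrite -leNgt leye_eq => /eqP ->; rewrite gt0_muley ?lte_fin// leye_eq.
  by move=> /eqP nuoo; have := lebesgue_outer_invariant_cell_le1; rewrite nuoo.
have c1 := fin 0%N; rewrite -(fineK c1) -EFinM.
set r := fine (nu (cell 1 0)); have r0 : (0 <= r)%R by rewrite fine_ge0.
pose w i := (p.2 ord0 i - p.1 ord0 i)%R.
have w0 i : (0 <= w i)%R by rewrite subr_ge0.
have bound n : nu (box p) <= (r * \prod_(i < d) (w i + 2 * n.+1%:R^-1))%:E.
  apply: le_trans (lebesgue_outer_invariant_box_cells _ n ab) _.
  have := lebesgue_outer_invariant_cell_le n.
  rewrite -(fineK (fin n)) -(fineK c1) -!EFinM !lee_fin -/r.
  set s := fine _ => sr.
  have -> : (\prod_(i < d) (n.+1%:R * (p.2 ord0 i - p.1 ord0 i) + 2) =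
      (n.+1 ^ d)%:R * \prod_(i < d) (w i + 2 * n.+1%:R^-1))%R.
    rewrite natrX -[X in (_ ^+ X)%R]card_ord -prodr_const -big_split/=.
    by apply: eq_bigr => i _; rewrite [RHS]mulrDr [in RHS]mulrCA;
      rewrite mulfV ?mulr1// pnatr_eq0.
  rewrite mulrAC; apply: ler_wpM2r => //.
  by apply: prodr_ge0 => i _; rewrite addr_ge0// mulr_ge0// invr_ge0.
have nufin : nu (box p) \is a fin_num.
  by rewrite ge0_fin_numE//; apply: le_lt_trans (bound 0%N) _; rewrite ltry.
rewrite -(fineK nufin) lee_fin.
have -> : box_volume p = (\prod_(i < d) w i)%R.
  by apply: eq_bigr => i _; apply/max_idPr; exact: w0.
have lim : ((r * \prod_(i < d) (w i + 2 * n.+1%:R^-1))%R @[n --> \oo] -->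
    (r * \prod_(i < d) w i)%R).
  apply: cvgMl_tmp; elim: (index_enum _) => [|i s IH].
    by rewrite big_nil; under eq_fun do rewrite big_nil; exact: cvg_cst.
  rewrite big_cons; under eq_fun do rewrite big_cons; apply: cvgM => //.
  rewrite -[X in _ --> X]addr0; apply: cvgD; first exact: cvg_cst.
  by rewrite -[X in _ --> X](mulr0 2%R); apply: cvgMl_tmp; exact: cvg_harmonic.
apply: (ler_cvg_to (@cvg_cst _ _ _ _ _) lim).
by near=> n; rewrite -lee_fin fineK.
Unshelve. all: by end_near. Qed.

(** The unit cells are countably many, cover the space, and all meet [C] in the same measure. *)
Lemma lebesgue_outer_invariant0 : nu (cell 1 0) = 0 -> lebesgue_outer C = 0.
Proof.
move=> nu0; rewrite (_ : C = \bigcup_(k : 'rV[int]_d) (C `&` cell 1 k)).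
  by apply: lebesgue_outer_countable0 => k; rewrite lebesgue_outer_invariant_cell.
apply/seteqP; split => [x Cx|x [k _ []]//].
exists (\row_i Num.ceil (x ord0 i))%R => //.
by split => // i; rewrite mul1r mxE.
Qed.

(** Let c be the value on the unit cell. For any cover of [C] within this cell by boxes, the density
    bound gives c <= c * (total volume); cancelling c leaves 1 <= total volume, and the infimum over
    covers is c itself. *)
Lemma lebesgue_outer_invariant_ge1 : nu (cell 1 0) != 0 -> 1 <= nu (cell 1 0).
Proof.
move=> nu0; apply: le_ereal_inf_tmp => _ [D [cD QD] <-].
have {}nu0 : 0 < nu (cell 1 0) by rewrite lt0e nu0 lebesgue_outer_ge0.
have nufin : nu (cell 1 0) \is a fin_num.
  rewrite ge0_fin_numE ?lebesgue_outer_ge0//.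
  by rewrite (le_lt_trans lebesgue_outer_invariant_cell_le1)// ltry.
have v0 p : 0 <= (box_volume p)%:E by rewrite lee_fin box_volume_ge0.
have [S [e [e_inj DE]]] := countable_enum _ _ cD.
rewrite DE esum_set_image// eseries_mkcond.
(* Indices outside [S] are padded with the empty set and with volume 0. *)
pose G n := if n \in S then C `&` box (e n) else set0.
pose v n := if n \in S then (box_volume (e n))%:E else 0.
have nuG n : lebesgue_outer (G n) <= nu (cell 1 0) * v n.
  rewrite /G /v; case: ifP => _; first exact: lebesgue_outer_invariant_box.
  by rewrite lebesgue_outer0 mule0.
rewrite -(@lee_pmul2l _ (nu (cell 1 0)))// mule1 -[X in _ <= X * _](fineK nufin).
rewrite -nneseriesZl => [|n _]; last by case: ifP.
rewrite fineK//.
apply: (@le_trans _ _ (\sum_(0 <= n <oo) lebesgue_outer (G n))).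
  apply: le_trans (lebesgue_outer_sigma_subadditive _).
  apply: le_lebesgue_outer => x Qx; have [p] := QD x Qx.
  rewrite DE => -[n Sn <-] px; exists n => //.
  by rewrite /G mem_set//; split => //; exact: Qx.1.
by apply: lee_nneseries => n *; [exact: lebesgue_outer_ge0|exact: nuG].
Qed.

End rational_invariance.

(** * Zero-one law and reflected translates with null overlap *)

Section overlap.
Context {R : realType} {d : nat}.
Implicit Types (A B C : set 'rV[R]_d) (t : 'rV[R]_d).
Local Open Scope ereal_scope.

(** If neither [C] nor its complement were null, each would have measure at least 1 in the unit
    cell, whose measure is at most 1. *)
Lemma rational_invariant_null C :
  measurable (C : set (lebesgue_space R d)) -> rational_invariant C ->
  lebesgue_outer C = 0 \/ lebesgue_outer (~` C) = 0.
Proof.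
move=> mC Crat.
have mC' : measurable (~` C : set (lebesgue_space R d)) by exact: measurableC.
have C'rat : rational_invariant (~` C).
  by move=> q x; split; apply: contra_not => /Crat.
have [c0|/(lebesgue_outer_invariant_ge1 _ mC Crat) c1] :=
  eqVneq (lebesgue_outer (C `&` cell 1 0)) 0.
  by left; exact: lebesgue_outer_invariant0.
have [c0|/(lebesgue_outer_invariant_ge1 _ mC' C'rat) c'1] :=
  eqVneq (lebesgue_outer (~` C `&` cell 1 0)) 0.
  by right; exact: lebesgue_outer_invariant0.
have := @lebesgue_outer_cell_le1 R d.
rewrite (mC (cell 1 0)) ![cell 1 0 `&` _]setIC => /(le_trans (leeD c1 c'1)).
by rewrite -EFinD lee_fin leNgt ltrDl ltr01.
Qed.

(** The Carathéodory condition for the reflected set at [X] is the one for [B] at the reflection of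
    [X]. *)
Lemma measurable_reflect t B : measurable (B : set (lebesgue_space R d)) ->
  measurable ([set x | B (t - x)%R] : set (lebesgue_space R d)).
Proof.
move=> mB; suff : lebesgue_outer.-caratheodory [set x | B (t - x)%R] by [].
move=> X; rewrite -[LHS](lebesgue_outer_reflect t) (mB [set x | X (t - x)%R]).
rewrite -[X in X + _](lebesgue_outer_reflect t).
rewrite -[X in _ + X](lebesgue_outer_reflect t).
by apply: (f_equal2 adde); congr lebesgue_outer;
  apply/seteqP; split => x /=; rewrite subKr.
Qed.

Lemma null_of_reflect_disjoint A B :
  measurable (B : set (lebesgue_space R d)) ->
  (forall t, lebesgue_outer (A `&` [set x | B (t - x)%R]) = 0) ->
  lebesgue_outer A = 0 \/ lebesgue_outer B = 0.
Proof.
move=> mB AB0.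
pose F (q : 'rV[rat]_d) : set 'rV[R]_d := [set x | B (map_mx ratr q - x)%R].
pose C := \bigcup_q F q.
have mC : measurable (C : set (lebesgue_space R d)).
  by apply: countable_bigcupT_measurable => // q; exact: measurable_reflect.
have Crat : rational_invariant C.
  move=> q x; split => -[q' _ xq'].
    by exists (q' - q)%R => //; move: xq'; rewrite /F/= map_mxB opprD addrA addrAC.
  exists (q' + q)%R => //; move: xq'.
  by rewrite /F/= map_mxD opprD addrACA addrN addr0.
have AC0 : lebesgue_outer (A `&` C) = 0.
  by rewrite setI_bigcupr; apply: lebesgue_outer_countable0 => q; exact: AB0.
have [C0|C0] := rational_invariant_null C mC Crat.
  right; apply/eqP; rewrite eq_le lebesgue_outer_ge0 andbT -C0.
  rewrite -(lebesgue_outer_reflect 0); apply: le_lebesgue_outer => x Bx.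
  by exists 0%R => //; rewrite /F/= map_mx0.
(* The Carathéodory condition for [C] with test set [A]: the first piece is null by countability,
   the second lies in the null complement of [C]. *)
have -> : lebesgue_outer A =
  lebesgue_outer (A `&` C) + lebesgue_outer (A `&` ~` C) by exact: mC.
left; rewrite AC0 add0e; apply/eqP; rewrite eq_le lebesgue_outer_ge0 andbT.
by rewrite -C0; apply: le_lebesgue_outer => x [].
Qed.

End overlap.

(** * Sums of translates *)

Section lebesgue_measureRd_integral.
Context {R : realType} {d : nat}.
Implicit Types (t l : 'rV[R]_d) (h : lebesgue_space R d -> \bar R).
Local Open Scope ereal_scope.
Local Notation mu := (lebesgue_measureRd R d).

(** Completeness: a set of outer measure 0 satisfies the Carathéodory condition by monotonicity, so
    it is itself a measurable null set. *)
Lemma negligible_lebesgueP (A : set (lebesgue_space R d)) :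
  mu.-negligible A <-> lebesgue_outer (A : set 'rV[R]_d) = 0.
Proof.
split=> [[N [mN N0 AN]]|A0].
  apply/eqP; rewrite eq_le lebesgue_outer_ge0 andbT -[leRHS]N0.
  exact: le_lebesgue_outer.
exists A; split => //.
suff : lebesgue_outer.-caratheodory (A : set 'rV[R]_d) by [].
apply: le_caratheodory_measurable => X.
suff : lebesgue_outer (X `&` A) + lebesgue_outer (X `&` ~` A) <=
  lebesgue_outer X by [].
have -> : lebesgue_outer (X `&` A) = 0.
  apply/eqP; rewrite eq_le lebesgue_outer_ge0 andbT -A0.
  by apply: le_lebesgue_outer => x [].
by rewrite add0e; apply: le_lebesgue_outer => x [].
Qed.

Lemma measurable_fun_reflect t (h : lebesgue_space R d -> \bar R) :
  measurable_fun [set: lebesgue_space R d] h ->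
  measurable_fun [set: lebesgue_space R d]
    (fun x : lebesgue_space R d => h (t - x)%R).
Proof.
move=> mh _ Y mY; rewrite setTI.
have := mh measurableT Y mY; rewrite setTI; exact: (measurable_reflect t).
Qed.

Lemma measurable_fun_translate l (h : lebesgue_space R d -> \bar R) :
  measurable_fun [set: lebesgue_space R d] h ->
  measurable_fun [set: lebesgue_space R d]
    (fun x : lebesgue_space R d => h (x - l)%R).
Proof.
move=> /(measurable_fun_reflect 0)/(measurable_fun_reflect l).
by congr measurable_fun; apply/funext => x; rewrite sub0r opprB.
Qed.

(** The pushforward of [mu] along x -> t - x is [mu], since reflections preserve the outer
    measure. *)
Lemma integral_reflect t h :
  measurable_fun [set: lebesgue_space R d] h -> (forall x, 0 <= h x) ->
  \int[mu]_x h (t - x)%R = \int[mu]_x h x.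
Proof.
move=> mh h0; pose phi (x : lebesgue_space R d) : lebesgue_space R d := (t - x)%R.
have mphi : measurable_fun [set: lebesgue_space R d] phi.
  by move=> _ Y mY; rewrite setTI; exact: measurable_reflect.
have := @ge0_integral_pushforward _ _ _ _ R _ mphi mu setT h measurableT mh.
rewrite preimage_setT => /(_ (fun y _ => h0 y)) <-.
by apply: eq_measure_integral => A _ _; exact: lebesgue_outer_reflect.
Qed.

Lemma integral_translate l h :
  measurable_fun [set: lebesgue_space R d] h -> (forall x, 0 <= h x) ->
  \int[mu]_x h (x - l)%R = \int[mu]_x h x.
Proof.
move=> mh h0; rewrite -[RHS](integral_reflect 0%R)//.
rewrite -(integral_reflect l (fun x => h (0 - x)%R))//; last first.
  exact: measurable_fun_reflect.
by apply: eq_integral => x _; rewrite sub0r opprB.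
Qed.

End lebesgue_measureRd_integral.

Lemma countable_of_fsum_le1 (R : realType) (T : choiceType) (L : set T)
    (a : T -> \bar R) :
  (forall B, finite_set B -> B `<=` L -> \sum_(l \in B) a l <= 1)%E ->
  countable [set l | L l /\ (0 < a l)%E].
Proof.
move=> sum_le.
rewrite [X in countable X](_ : _ =
    \bigcup_m [set l | L l /\ ((m.+1%:R^-1)%:E < a l)%E]); last first.
  apply/seteqP; split => [l [Ll al]|l [m _ [Ll al]]]; last first.
    by split=> //; apply: le_lt_trans al; rewrite lee_fin.
  have [aoo|aoo] := eqVneq (a l) +oo%E.
    by exists 0%N => //; split; rewrite // aoo ltry.
  have afin : a l \is a fin_num by rewrite ge0_fin_numE ?ltey// ltW.
  have : 0 < fine (a l) by rewrite fine_gt0// al ltey.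
  move=> /ltr_add_invr[m]; rewrite add0r => ma; exists m => //; split => //.
  by rewrite -(fineK afin) lte_fin.
apply: bigcup_countable => // m _; apply: finite_set_countable.
(* Already m + 2 terms above 1/(m+1) have a sum strictly greater than 1. *)
apply: contrapT => /(infinite_set_fset m.+2)[B BL mB].
have := sum_le _ (finite_fset B) (fun l Bl => (BL l Bl).1).
rewrite leNgt => /negP; apply; rewrite -fsbig_seq ?finmap.fset_uniq//.
apply: (@lt_le_trans _ _
  (\sum_(l <- finmap.enum_fset B) (m.+1%:R^-1)%:E)%R); last first.
  by rewrite !big_seq; apply: lee_sum => l lB; apply/ltW/(BL l lB).2.
rewrite sumEFin lte_fin big_const_seq count_predT iter_addr addr0.
rewrite -[X in _ < X]mulr_natl ltr_pdivlMr ?ltr0n// mul1r ltr_nat.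
exact: mB.
Qed.

(** * Packings, countability of the translation set, and tilings *)

Section packing.
Context {R : realType} {d : nat}.
Implicit Types (f g : 'rV[R]_d -> R) (L : set 'rV[R]_d).
Local Open Scope ereal_scope.
Local Notation mu := (lebesgue_measureRd R d).

Lemma lebesgue_measure_cell_le1 (k : 'rV[int]_d) : mu (cell 1 k) <= 1.
Proof.
have Tinv : rational_invariant [set: 'rV[R]_d] by [].
have := lebesgue_outer_invariant_cell _ Tinv 0 k; rewrite !setTI => kE.
rewrite [leLHS]kE; exact: lebesgue_outer_cell_le1.
Qed.

(** Each translate of f has nonzero integral, hence positive integral over some unit cell. Over a
    fixed cell the packing bound makes finite sums of these integrals at most 1, so only countably
    many are positive. *)
Lemma countable_packing f L : (forall x, 0 <= f x)%R ->
  measurable_fun [set: lebesgue_space R d] f ->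
  \int[mu]_x (f x)%:E != 0 -> is_packing f L -> countable L.
Proof.
move=> f0 mf If fL.
have mfE : measurable_fun [set: lebesgue_space R d] (fun x => (f x)%:E).
  exact/measurable_EFinP.
have mfl l : measurable_fun [set: lebesgue_space R d] (fun x => (f (x - l)%R)%:E).
  exact: (measurable_fun_translate l _ mfE).
(* An enumeration of the unit cells; [pickle_inv] answers only on genuine codes, so no cell is
   repeated and the family stays disjoint. *)
pose F (n : nat) : set (lebesgue_space R d) :=
  if pickle_inv n is Some k then cell 1 (k : 'rV[int]_d) else set0.
have mF n : measurable (F n).
  by rewrite /F; case: pickle_inv => [k|//]; exact: measurable_cell.
have F1 n : mu (F n) <= 1.
  rewrite /F; case: pickle_inv => [k|]; first exact: lebesgue_measure_cell_le1.
  by rewrite measure0.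
have FT : \bigcup_n F n = setT.
  apply/seteqP; split => // x _.
  exists (pickle (\row_i Num.ceil ((x : 'rV[R]_d) ord0 i))%R) => //.
  by rewrite /F pickleK_inv => i; rewrite mul1r mxE.
have tF : trivIset setT F.
  move=> n m _ _; rewrite /F.
  have := @pickle_invK 'rV[int]_d n; have := @pickle_invK 'rV[int]_d m.
  case: pickle_inv => [k|] /= mk; last by move=> _; rewrite setI0 => -[x []].
  case: pickle_inv => [l|] /= nl; last by rewrite set0I => -[x []].
  by move=> /(trivIset_cell 1 _ _ Logic.I Logic.I) lk; rewrite -mk -nl lk.
pose a (n : nat) l := \int[mu]_(x in F n) (f (x - l)%R)%:E.
have a0 n l : 0 <= a n l by apply: integral_ge0 => x _; rewrite lee_fin.
rewrite (_ : L = \bigcup_n [set l | L l /\ 0 < a n l]); last first.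
  apply/seteqP; split => [l Ll|l [n _ []]//].
  apply: contrapT => nl; move/eqP: If; apply.
  rewrite -(integral_translate l _ mfE) => [|x]; last by rewrite lee_fin.
  rewrite -FT ge0_integral_bigcup// ?FT//; last by move=> x _; rewrite lee_fin.
  rewrite eseries0// => n _ _; apply: contrapT => /eqP n0; apply: nl.
  by exists n => //; split => //; rewrite lt0e n0 a0.
apply: bigcup_countable => // n _; apply: countable_of_fsum_le1.
move=> B finB BL; rewrite fsbig_finite//=.
rewrite -ge0_integral_sum//; first last.
- by move=> l x _; rewrite lee_fin.
- by move=> l; exact/measurable_funTS/mfl.
apply: (@le_trans _ _ (\int[mu]_(x in F n) 1)).
  apply: ae_ge0_le_integral => //.
  - by move=> x _; apply: sume_ge0 => l _; rewrite lee_fin.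
  - by apply: emeasurable_sum => l; exact: measurable_funTS.
  apply: (negligibleS _ fL) => x; apply: contra_not => fx _; apply: le_trans fx.
  apply: esum_ge; exists B; first by split.
  by rewrite fsbig_finite.
by rewrite integral_cst// mul1e; exact: F1.
Qed.

(** The series form, padded by 0 outside [S], gives access to measurability and termwise
    integration. *)
Lemma esum_translatesE f (S : set nat) (e : nat -> 'rV[R]_d) :
  (forall x, 0 <= f x)%R -> set_inj S e -> forall x,
  \esum_(l in e @` S) (f (x - l)%R)%:E =
  \sum_(0 <= n <oo) if n \in S then (f (x - e n)%R)%:E else 0.
Proof.
move=> f0 e_inj x; rewrite (esum_set_image (fun l => (f (x - l)%R)%:E))//.
  by rewrite eseries_mkcond.
by move=> n _; rewrite lee_fin.
Qed.

Lemma mule_esum_translatesE (c : R) f (S : set nat)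
    (e : nat -> 'rV[R]_d) (x : 'rV[R]_d) :
  (forall x, 0 <= f x)%R -> set_inj S e ->
  (c%:E * \esum_(l in e @` S) (f (x - l)%R)%:E)%E =
  \sum_(0 <= n <oo) if n \in S then (c * f (x - e n)%R)%:E else 0.
Proof.
move=> f0 e_inj; rewrite esum_translatesE// -nneseriesZl; last first.
  by move=> n _; case: ifP => // _; rewrite lee_fin.
by apply: eq_eseriesr => n _; case: ifP; rewrite ?mule0 ?EFinM.
Qed.

Lemma measurable_esum_translates f L : (forall x, 0 <= f x)%R ->
  measurable_fun [set: lebesgue_space R d] f -> countable L ->
  measurable_fun [set: lebesgue_space R d]
    (fun x : lebesgue_space R d => \esum_(l in L) (f ((x : 'rV[R]_d) - l)%R)%:E).
Proof.
move=> f0 mf /countable_enum[S [e [e_inj ->]]].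
under eq_fun do rewrite esum_translatesE//.
apply: (@ge0_emeasurable_sum _ _ _ setT
  (fun n (x : lebesgue_space R d) =>
     if n \in S then (f (x - e n)%R)%:E else 0) xpredT).
  by move=> n x _ _; case: ifP => // _; rewrite lee_fin.
move=> n _ /=; case: (n \in S) => //.
apply: (measurable_fun_translate (e n) (fun x => (f x)%:E)).
exact/measurable_EFinP.
Qed.

(* Both sides are the sum over l in L of the integrals of
   f(y) g(t - l - y), after the substitution x = y + l on the left. *)
Lemma integral_esum_translatesC f g L (t : 'rV[R]_d) :
  (forall x, 0 <= f x)%R -> (forall x, 0 <= g x)%R ->
  measurable_fun [set: lebesgue_space R d] f ->
  measurable_fun [set: lebesgue_space R d] g -> countable L ->
  \int[mu]_x ((g (t - x)%R)%:E * \esum_(l in L) (f (x - l)%R)%:E) =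
  \int[mu]_y ((f y)%:E * \esum_(l in L) (g (t - y - l)%R)%:E).
Proof.
move=> f0 g0 mf mg /countable_enum[S [e [e_inj ->]]].
have mfE : measurable_fun [set: lebesgue_space R d] (fun x => (f x)%:E).
  exact/measurable_EFinP.
have mgE : measurable_fun [set: lebesgue_space R d] (fun x => (g x)%:E).
  exact/measurable_EFinP.
pose p n (x : lebesgue_space R d) : \bar R :=
  if n \in S then (g (t - x)%R * f (x - e n)%R)%:E else 0.
pose q n (y : lebesgue_space R d) : \bar R :=
  if n \in S then (f y * g (t - y - e n)%R)%:E else 0.
have mp n : measurable_fun [set: lebesgue_space R d] (p n).
  rewrite /p; case: (n \in S) => //; under eq_fun do rewrite EFinM.
  apply: emeasurable_funM.
    exact: (measurable_fun_reflect t (fun x => (g x)%:E)).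
  exact: (measurable_fun_translate (e n) (fun x => (f x)%:E)).
have mq n : measurable_fun [set: lebesgue_space R d] (q n).
  rewrite /q; case: (n \in S) => //; under eq_fun do rewrite EFinM.
  apply: emeasurable_funM => //.
  apply: (measurable_fun_reflect t (fun z => (g (z - e n)%R)%:E)).
  exact: (measurable_fun_translate (e n) (fun x => (g x)%:E)).
have p0 n x : 0 <= p n x by rewrite /p; case: ifP => // _; rewrite lee_fin mulr_ge0.
have q0 n y : 0 <= q n y by rewrite /q; case: ifP => // _; rewrite lee_fin mulr_ge0.
transitivity (\int[mu]_x \sum_(0 <= n <oo) p n x).
  by apply: eq_integral => x _; rewrite mule_esum_translatesE.
transitivity (\int[mu]_y \sum_(0 <= n <oo) q n y); last first.
  by apply: eq_integral => y _; rewrite mule_esum_translatesE.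
rewrite !integral_nneseries//.
apply: eq_eseriesr => n _; rewrite -[RHS](integral_translate (e n))//.
apply: eq_integral => x _; rewrite /p /q; case: ifP => // _.
by rewrite mulrC (_ : t - (x - e n) - e n = t - x)%R// opprB addrA addrAC addrK.
Qed.

(** For each t, f(y) G(t - y) is a.e. at most f(y) and has the same integral, so the two agree a.e.;
    wherever they agree and f(y) is nonzero, G(t - y) = 1. *)
Lemma ae_eq1_of_convolution f (G : 'rV[R]_d -> \bar R) : (forall x, 0 <= f x)%R ->
  measurable_fun [set: lebesgue_space R d] f -> \int[mu]_x (f x)%:E = 1 ->
  (forall x, 0 <= G x) ->
  measurable_fun [set: lebesgue_space R d] (G : lebesgue_space R d -> _) ->
  {ae mu, forall x : 'rV[R]_d, G x <= 1} ->
  (forall t, \int[mu]_y ((f y)%:E * G (t - y)%R) = 1) ->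
  {ae mu, forall x : 'rV[R]_d, G x = 1}.
Proof.
move=> f0 mf f1 G0 mG Gle1 fG1.
have mfE : measurable_fun [set: lebesgue_space R d] (fun x => (f x)%:E).
  exact/measurable_EFinP.
pose A : set 'rV[R]_d := [set x | f x != 0%R].
pose B : set 'rV[R]_d := [set x | G x != 1].
have mB : measurable (B : set (lebesgue_space R d)).
  have := emeasurable_neq measurableT mG 1; rewrite setTI; exact.
have [t|A0|B0] := null_of_reflect_disjoint A B mB.
- pose h (y : lebesgue_space R d) := (f y)%:E * G (t - y)%R.
  have mh : measurable_fun [set: lebesgue_space R d] h.
    exact: (emeasurable_funM mfE (measurable_fun_reflect t _ mG)).
  have h0 y : 0 <= h y by rewrite mule_ge0// lee_fin.
  have fE0 y : 0 <= (f y)%:E by rewrite lee_fin.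
  have mfh : measurable_fun [set: lebesgue_space R d] (fun y => (f y)%:E - h y).
    exact: (emeasurable_funB mfE mh).
  (* Since h <= f only a.e., the absolute value keeps the gap nonnegative everywhere; f = h + k a.e.
     then forces k to have integral 0. *)
  pose k (y : lebesgue_space R d) := `|(f y)%:E - h y|.
  have mk : measurable_fun [set: lebesgue_space R d] k.
    exact: (measurableT_comp _ mfh).
  have k0 y : 0 <= k y by exact: abse_ge0.
  have fhk : \int[mu]_y (f y)%:E = \int[mu]_y (h y + k y).
    apply: (ge0_ae_eq_integral measurableT mfE (emeasurable_funD mh mk)).
    + by move=> y _; exact: fE0.
    + by move=> y _; exact: adde_ge0 (h0 y) (k0 y).
    have Gt : lebesgue_outer (~` [set y : 'rV[R]_d | G (t - y)%R <= 1]) = 0.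
      move/negligible_lebesgueP: Gle1 => Gle1.
      by rewrite -[RHS]Gle1 -[RHS](lebesgue_outer_reflect t).
    apply/negligible_lebesgueP/eqP; rewrite eq_le lebesgue_outer_ge0 andbT -Gt.
    apply: le_lebesgue_outer => y; apply: contra_not => /= Gy _.
    have hf : h y <= (f y)%:E.
      by rewrite -[leRHS]mule1; exact: lee_wpmul2l (fE0 y) _ _ Gy.
    have hfin : h y \is a fin_num.
      by rewrite ge0_fin_numE// (le_lt_trans hf)// ltry.
    suff : (f y)%:E = h y + k y by [].
    have fh0 : 0 <= (f y)%:E - h y by rewrite sube_ge0 ?hfin ?orbT.
    by rewrite /k (gee0_abs fh0) addeC subeK.
  have kint0 : \int[mu]_y k y = 0.
    move: fhk; rewrite (ge0_integralD mu measurableT (fun y _ => h0 y) mh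
      (fun y _ => k0 y) mk) f1 (fG1 t) -[LHS]adde0.
    by case: (\int[mu]_y k y) => [r|//|//]; rewrite -!EFinD => -[] /addrI <-.
  have /negligible_lebesgueP AB0 :=
    (ae_eq_integral_abs mu measurableT mfh).1 kint0.
  apply/eqP; rewrite eq_le lebesgue_outer_ge0 andbT -AB0.
  apply: le_lebesgue_outer => y [fy Gy] /(_ Logic.I); rewrite /h /=.
  have {}fy : (0 < f y)%R by rewrite lt0r fy f0.
  (* A finite value r gives f(y) = f(y) r, hence r = 1; the value +oo would make the difference
     infinite, not 0. *)
  move: Gy (G0 (t - y)%R); rewrite /B /=; case: (G _) => [r r1 _|_ _|//].
    rewrite -EFinM -EFinB => -[/eqP]; rewrite subr_eq0 -[X in X == _]mulr1.
    move=> /eqP /(mulfI (lt0r_neq0 fy)) r1E.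
    by move: r1; rewrite -r1E eqxx.
  by rewrite gt0_muley ?lte_fin.
- have : \int[mu]_x (f x)%:E = \int[mu]_x cst 0 x.
    apply: (ge0_ae_eq_integral measurableT mfE (measurable_cst _)).
    + by move=> x _; rewrite lee_fin.
    + by [].
    apply/negligible_lebesgueP/eqP; rewrite eq_le lebesgue_outer_ge0 andbT -A0.
    apply: le_lebesgue_outer => x /=; apply: contra_notT => /negPn/eqP fx0 _.
    by rewrite fx0.
  by rewrite f1 integral_cst// mul0e => /eqP; rewrite onee_eq0.
- apply/negligible_lebesgueP; rewrite -[RHS]B0; congr lebesgue_outer.
  by apply/seteqP; split => x /= /eqP.
Qed.

Lemma tiling_packing f g L : (forall x, 0 <= f x)%R -> (forall x, 0 <= g x)%R ->
  measurable_fun [set: lebesgue_space R d] f ->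
  measurable_fun [set: lebesgue_space R d] g ->
  \int[mu]_x (f x)%:E = 1 -> \int[mu]_x (g x)%:E = 1 ->
  is_tiling f L -> is_packing g L -> is_tiling g L.
Proof.
move=> f0 g0 mf mg f1 g1 fL gL.
have cL : countable L.
  by apply: (countable_packing g L g0 mg _ gL); rewrite g1 onee_neq0.
have mgE : measurable_fun [set: lebesgue_space R d] (fun x => (g x)%:E).
  exact/measurable_EFinP.
apply: (ae_eq1_of_convolution f _ f0 mf f1 _
  (measurable_esum_translates g L g0 mg cL) gL) => [x|t].
  by apply: esum_ge0 => l _; rewrite lee_fin.
have mgt := measurable_fun_reflect t _ mgE.
(* After the exchange, the tiling by f replaces its sum by 1 a.e., and what remains is the integral
   of the reflected g. *)
rewrite -(integral_esum_translatesC f g L t f0 g0 mf mg cL).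
rewrite -g1 -(integral_reflect t _ mgE); last by move=> x; rewrite lee_fin.
apply: (ge0_ae_eq_integral measurableT _ mgt).
- exact: (emeasurable_funM mgt (measurable_esum_translates f L f0 mf cL)).
- move=> x _; apply: mule_ge0; first by rewrite lee_fin.
  by apply: esum_ge0 => l _; rewrite lee_fin.
- by move=> x _; rewrite lee_fin.
apply: (negligibleS _ fL) => x; apply: contra_not => /= Fx _.
by rewrite Fx mule1.
Qed.

End packing.

Theorem theorem2 (R : realType) (d : nat) (f g : 'rV[R]_d -> R)
    (L : set 'rV[R]_d)
    (f_ge0 : forall x, 0 <= f x) (g_ge0 : forall x, 0 <= g x)
    (f_meas : measurable_fun [set: lebesgue_space R d] f)
    (g_meas : measurable_fun [set: lebesgue_space R d] g)
    (f_int : (\int[lebesgue_measureRd R d]_x (f x)%:E = 1)%E)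
    (g_int : (\int[lebesgue_measureRd R d]_x (g x)%:E = 1)%E)
    (f_pack : is_packing f L) (g_pack : is_packing g L) :
  is_tiling f L <-> is_tiling g L.
Proof.
by split=> [fL|gL]; [exact: (tiling_packing f)|exact: (tiling_packing g)].
Qed.
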